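(* Let $A$ be a two-sided skew brace. Then $A^2\cap A^2_{\mathrm{op}}$ is contained in the center $Z(A^2+A^2_{\mathrm{op}},+)$ of the additive group of $A^2+A^2_{\mathrm{op}}$. In particular, $A^2\cap A^2_{\mathrm{op}}$ is a two-sided brace.
   Context: A skew (left) brace is a triple $(A,+,\circ)$ such that $(A,+)$ and $(A,\circ)$ are (not necessarily abelian) groups and $a\circ(b+c)=a\circ b-a+a\circ c$ for all $a,b,c\in A$. The two groups share the same identity element, denoted $0$. It is two-sided if moreover $(a+b)\circ c=a\circ c-c+b\circ c$ for all $a,b,c\in A$. A brace is a skew brace whose additive group is abelian; a two-sided brace is a brace that is two-sided. For $a,b\in A$ put $a*b=-a+a\circ b-b$ and $a*_{\mathrm{op}}b=-b+a\circ b-a$. Let $A^2$ be the subgroup of $(A,+)$ generated by all $a*b$ ($a,b\in A$), and $A^2_{\mathrm{op}}$ the subgroup of $(A,+)$ generated by all $a*_{\mathrm{op}}b$ ($a,b\in A$). Both are ideals of $A$, where an ideal is a subset $I$ that is a normal subgroup of both $(A,+)$ and $(A,\circ)$ and satisfies $-a+a\circ x\in I$ for all $a\in A$, $x\in I$; in particular ideals are skew braces under the restricted operations. *)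

(* Defs.v *)
From HB Require Import structures.
From mathcomp Require Import all_boot.
From mathcomp Require Import boolp classical_sets.

Set Implicit Arguments.
Unset Strict Implicit.
Unset Printing Implicit Defensive.

Import Algebra.

Declare Scope brace_scope.
Delimit Scope brace_scope with brace.

(* The library's additive groups are commutative, so the possibly non-abelian
   group (A, +, 0, -) is part of the mixin. The inherited groupType structure is
   the second group (A, ∘), with identity 1%g and inverse (a^-1)%g. *)
HB.mixin Record isSkewBrace A of Group A := {
  sbadd : A -> A -> A;
  sbzero : A;
  sbopp : A -> A;
  sbaddA : associative sbadd;
  sbadd0 : left_id sbzero sbadd;
  sbaddr0 : right_id sbzero sbadd;
  sbaddN : left_inverse sbzero sbopp sbadd;
  sbaddrN : right_inverse sbzero sbopp sbadd;
  sbcircD : forall a b c : A,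
    mul a (sbadd b c) = sbadd (sbadd (mul a b) (sbopp a)) (mul a c)
}.

#[short(type="skewBraceType")]
HB.structure Definition SkewBrace :=
  {A of isSkewBrace A & Group A}.

Notation "a ∘ b" := (@mul _ a b)
  (at level 40, left associativity) : brace_scope.
Notation "a + b" := (@sbadd _ a b) : brace_scope.
Notation "- a" := (@sbopp _ a) : brace_scope.
Notation "a - b" := (a + - b)%brace : brace_scope.
Notation "0" := (@sbzero _) : brace_scope.

Local Open Scope classical_set_scope.
Local Open Scope brace_scope.

Definition two_sided (A : skewBraceType) : Prop :=
  forall a b c : A, (a + b) ∘ c = a ∘ c - c + b ∘ c.

Definition is_brace (A : skewBraceType) : Prop := commutative (@sbadd A).

Definition is_two_sided_brace (A : skewBraceType) : Prop :=
  is_brace A /\ two_sided A.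

Definition add_subgroup (A : skewBraceType) (S : set A) : Prop :=
  [/\ S 0, (forall x y, S x -> S y -> S (x + y)) & (forall x, S x -> S (- x))].

Definition add_normal (A : skewBraceType) (S : set A) : Prop :=
  add_subgroup S /\ (forall a x, S x -> S (a + x - a)).

Definition circ_subgroup (A : skewBraceType) (S : set A) : Prop :=
  [/\ S 1%g, (forall x y, S x -> S y -> S (x ∘ y))
    & (forall x, S x -> S (x^-1)%g)].

Definition circ_normal (A : skewBraceType) (S : set A) : Prop :=
  circ_subgroup S /\ (forall a x, S x -> S (a ∘ x ∘ (a^-1)%g)).

Definition is_ideal (A : skewBraceType) (S : set A) : Prop :=
  [/\ add_normal S, circ_normal S & forall a x, S x -> S (- a + a ∘ x)].

Record ideal (A : skewBraceType) := Ideal {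
  ideal_set :> set A;
  idealP : is_ideal ideal_set
}.

Definition add_gen (A : skewBraceType) (S : set A) : set A :=
  smallest (@add_subgroup A) S.

Definition star (A : skewBraceType) (a b : A) : A := - a + a ∘ b - b.

Definition star_op (A : skewBraceType) (a b : A) : A := - b + a ∘ b - a.

Definition sqr_set (A : skewBraceType) : set A :=
  add_gen [set z | exists a b : A, z = star a b].

Arguments sqr_set A : clear implicits.

Definition sqr_op_set (A : skewBraceType) : set A :=
  add_gen [set z | exists a b : A, z = star_op a b].

Arguments sqr_op_set A : clear implicits.

Definition add_set (A : skewBraceType) (S T : set A) : set A :=
  [set z | exists x y, [/\ S x, T y & z = x + y]].

Definition add_center (A : skewBraceType) (S : set A) : set A :=
  [set z | S z /\ forall x, S x -> z + x = x + z].

Section SkewBraceTheory.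
Variable A : skewBraceType.
Implicit Types (a b c x y : A) (S : set A).

Lemma sbaddKN x y : - x + (x + y) = y.
Proof. by rewrite sbaddA sbaddN sbadd0. Qed.

Lemma sbaddNK x y : x + (- x + y) = y.
Proof. by rewrite sbaddA sbaddrN sbadd0. Qed.

Lemma sbaddI a x y : a + x = a + y -> x = y.
Proof. by move=> e; rewrite -(sbaddKN a x) e sbaddKN. Qed.

Lemma sboppK x : - - x = x.
Proof. by apply: (@sbaddI (- x)); rewrite sbaddrN sbaddN. Qed.

Lemma sboppD x y : - (x + y) = - y - x.
Proof.
by apply: (@sbaddI (x + y)); rewrite sbaddrN -sbaddA sbaddNK sbaddrN.
Qed.

Lemma circ_zero a : a ∘ 0 = a.
Proof.
have := sbcircD a 0 0; rewrite sbadd0 -sbaddA -[LHS]sbaddr0 => /sbaddI e.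
by apply: (@sbaddI (- a)); rewrite -e sbaddN.
Qed.

Lemma one_zero : 1%g = 0 :> A.
Proof. by rewrite -(circ_zero 1%g) mul1g. Qed.

Lemma star_addr a b c : b + star a c - b = - star a b + star a (b + c).
Proof.
rewrite /star sbcircD !sboppD !sboppK -!sbaddA; congr (b + _).
by rewrite !(sbaddKN, sbaddNK).
Qed.

Lemma star_op_addr a b c :
  - c + star_op a b + c = star_op a (b + c) - star_op a c.
Proof.
by rewrite /star_op sbcircD !sboppD !sboppK -!sbaddA !(sbaddKN, sbaddNK).
Qed.

Lemma sub_add_gen S : S `<=` add_gen S.
Proof. exact: sub_gen_smallest. Qed.

Lemma add_gen_subgroup S : add_subgroup (add_gen S).
Proof.
rewrite /add_gen /smallest /bigcap /=.
split=> [|x y Sx Sy|x Sx] T [TG ST]; have [T0 TD TN] := TG; first by [].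
  by apply: TD; [apply: Sx | apply: Sy].
by apply: TN; apply: Sx.
Qed.

Lemma add_gen_normal S :
  (forall a x, S x -> add_gen S (a + x - a)) -> add_normal (add_gen S).
Proof.
move=> nS; split=> [|a]; first exact: add_gen_subgroup.
have [G0 GD GN] := add_gen_subgroup S.
apply: (@smallest_sub _ _ _ [set x | add_gen S (a + x - a)]) => [|x Sx]; last exact: nS.
split=> /= [|x y Gx Gy|x Gx]; first by rewrite sbaddr0 sbaddrN.
  by have := GD _ _ Gx Gy; rewrite -!sbaddA sbaddKN.
by have := GN _ Gx; rewrite !sboppD sboppK sbaddA.
Qed.

Lemma add_normal_swap S x y : add_normal S -> S (x + y) -> S (y + x).
Proof.
by move=> [_ nS] /(nS (- x)); rewrite sbaddA sboppK sbaddN sbadd0.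
Qed.

(* An additive normal subgroup is an ideal as soon as ∘ induces on the additive
   quotient the operation + or its opposite. *)
Lemma ideal_criterion S : add_normal S ->
  (forall a b, S (star a b)) \/ (forall a b, S (star_op a b)) -> is_ideal S.
Proof.
move=> nS hS; have [[S0 SD SN] SJ] := nS.
have sw := add_normal_swap nS.
have lamS a x : S x -> S (- a + a ∘ x).
  move=> Sx; case: hS => hS.
    by have := SD _ _ (hS a x) Sx; rewrite /star -!sbaddA sbaddN sbaddr0.
  by apply: (sw); have := SD _ _ Sx (hS a x); rewrite /star_op -sbaddA sbaddNK.
have conS a x : S x -> S (a ∘ x ∘ (a^-1)%g).
  move=> Sx; set u := a ∘ x; set v := (a^-1)%g.
  have Su : S (- a + u) by exact: lamS.
  have av : a ∘ v = 0 by rewrite mulgV one_zero.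
  case: hS => hS.
    have Suv := hS u v; have Sav := hS a v; rewrite /star av sbaddr0 in Sav.
    have Sva : S (v + a) by have := SN _ Sav; rewrite sboppD !sboppK.
    have := SD _ _ (SD _ _ Su Suv) Sva.
    rewrite /star -!sbaddA !(sbaddKN, sbaddNK) => Sw.
    by have := sw _ _ Sw; rewrite -sbaddA sbaddrN sbaddr0.
  have Suv := hS u v; have Sav := hS a v; rewrite /star_op av sbaddr0 in Sav.
  have Sav' : S (a + v) by have := SN _ Sav; rewrite sboppD !sboppK.
  have := SD _ _ (SD _ _ Suv (sw _ _ Su)) Sav'.
  rewrite /star_op -!sbaddA !(sbaddKN, sbaddNK) => Sw.
  by have := sw _ _ Sw; rewrite -sbaddA sbaddrN sbaddr0.
split=> //; split=> //; split=> [|x y Sx Sy|x Sx]; first by rewrite one_zero.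
  by have := SD _ _ Sx (lamS x y Sy); rewrite sbaddNK.
by have := SN _ (lamS (x^-1)%g x Sx); rewrite mulVg one_zero sbaddr0 sboppK.
Qed.

Lemma sqr_ideal : is_ideal (sqr_set A).
Proof.
have [_ GD GN] := add_gen_subgroup [set z | exists a b : A, z = star a b].
have G a b : sqr_set A (star a b) by apply: sub_add_gen; exists a, b.
apply: ideal_criterion; last by left.
apply: add_gen_normal => b _ [a [c ->]]; rewrite star_addr.
exact: (GD _ _ (GN _ (G _ _)) (G _ _)).
Qed.

Lemma sqr_op_ideal : is_ideal (sqr_op_set A).
Proof.
have [_ GD GN] := add_gen_subgroup [set z | exists a b : A, z = star_op a b].
have G a b : sqr_op_set A (star_op a b) by apply: sub_add_gen; exists a, b.
apply: ideal_criterion; last by right.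
apply: add_gen_normal => c _ [a [b ->]].
rewrite -{1}(sboppK c) star_op_addr.
exact: (GD _ _ (G _ _) (GN _ (G _ _))).
Qed.

Lemma setI_ideal S T : is_ideal S -> is_ideal T -> is_ideal (S `&` T).
Proof.
move=> [[[S0 SD SN] SJ] [[S1 SM SV] SC] SL] [[[T0 TD TN] TJ] [[T1 TM TV] TC] TL].
split; [split; first split|split; first split|]; do ?by [].
- by move=> x y [? ?] [? ?]; split; [apply: SD | apply: TD].
- by move=> x [? ?]; split; [apply: SN | apply: TN].
- by move=> a x [? ?]; split; [apply: SJ | apply: TJ].
- by move=> x y [? ?] [? ?]; split; [apply: SM | apply: TM].
- by move=> x [? ?]; split; [apply: SV | apply: TV].
- by move=> a x [? ?]; split; [apply: SC | apply: TC].
- by move=> a x [? ?]; split; [apply: SL | apply: TL].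
Qed.

End SkewBraceTheory.

Definition sqr (A : skewBraceType) : ideal A := Ideal (@sqr_ideal A).

Definition sqr_op (A : skewBraceType) : ideal A := Ideal (@sqr_op_ideal A).

Definition idealI (A : skewBraceType) (I J : ideal A) : ideal A :=
  Ideal (setI_ideal (idealP I) (idealP J)).

Definition ideal_type (A : skewBraceType) (I : ideal A) : Type := set_type I.

Section RestrictedSkewBrace.
Variables (A : skewBraceType) (I : ideal A).
Local Notation T := (ideal_type I).

HB.instance Definition _ := SubChoice.copy T (set_type I).

Lemma ideal_typeP (u : T) : ideal_set I (val u).
Proof. exact: set_mem (valP u). Qed.

Definition itype_of x (Ix : ideal_set I x) : T := exist _ x (mem_set Ix).

Lemma iadd_subproof (u v : T) : ideal_set I (val u + val v).
Proof. by have [[[_ ID _] _] _ _] := idealP I; apply: ID; apply: ideal_typeP. Qed.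

Lemma izero_subproof : ideal_set I 0.
Proof. by have [[[]]] := idealP I. Qed.

Lemma iopp_subproof (u : T) : ideal_set I (- val u).
Proof. by have [[[_ _ IN] _] _ _] := idealP I; apply: IN; apply: ideal_typeP. Qed.

Lemma icirc_subproof (u v : T) : ideal_set I (val u ∘ val v).
Proof. by have [_ [[_ IM _] _] _] := idealP I; apply: IM; apply: ideal_typeP. Qed.

Lemma ione_subproof : ideal_set I 1%g.
Proof. by have [_ [[]]] := idealP I. Qed.

Lemma iinv_subproof (u : T) : ideal_set I ((val u)^-1)%g.
Proof. by have [_ [[_ _ IV] _] _] := idealP I; apply: IV; apply: ideal_typeP. Qed.

Definition iadd (u v : T) : T := itype_of (iadd_subproof u v).
Definition izero : T := itype_of izero_subproof.
Definition iopp (u : T) : T := itype_of (iopp_subproof u).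
Definition icirc (u v : T) : T := itype_of (icirc_subproof u v).
Definition ione : T := itype_of ione_subproof.
Definition iinv (u : T) : T := itype_of (iinv_subproof u).

Fact icircA : associative icirc.
Proof. by move=> u v w; apply: val_inj; rewrite /= mulgA. Qed.
Fact icirc1 : left_id ione icirc.
Proof. by move=> u; apply: val_inj; rewrite /= mul1g. Qed.
Fact icircr1 : right_id ione icirc.
Proof. by move=> u; apply: val_inj; rewrite /= mulg1. Qed.
Fact icircV : left_inverse ione iinv icirc.
Proof. by move=> u; apply: val_inj; rewrite /= mulVg. Qed.
Fact icircrV : right_inverse ione iinv icirc.
Proof. by move=> u; apply: val_inj; rewrite /= mulgV. Qed.

HB.instance Definition _ := isGroup.Build T icircA icirc1 icircr1 icircV icircrV.

Fact iaddA : associative iadd.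
Proof. by move=> u v w; apply: val_inj; rewrite /= sbaddA. Qed.
Fact iadd0 : left_id izero iadd.
Proof. by move=> u; apply: val_inj; rewrite /= sbadd0. Qed.
Fact iaddr0 : right_id izero iadd.
Proof. by move=> u; apply: val_inj; rewrite /= sbaddr0. Qed.
Fact iaddN : left_inverse izero iopp iadd.
Proof. by move=> u; apply: val_inj; rewrite /= sbaddN. Qed.
Fact iaddrN : right_inverse izero iopp iadd.
Proof. by move=> u; apply: val_inj; rewrite /= sbaddrN. Qed.
Fact icircD (u v w : T) : u ∘ iadd v w = iadd (iadd (u ∘ v) (iopp u)) (u ∘ w).
Proof. by apply: val_inj; rewrite /= sbcircD. Qed.

HB.instance Definition _ :=
  isSkewBrace.Build T iaddA iadd0 iaddr0 iaddN iaddrN icircD.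

End RestrictedSkewBrace.

(* Main.v *)
Require Import Defs.
From HB Require Import structures.
From mathcomp Require Import all_boot.
From mathcomp Require Import boolp classical_sets.

(** Expanding [(a + b) ∘ (c + d)] first with left and then with right
    distributivity shows that every [star_op b c] commutes additively with
    every [star a d]. Hence [sqr_op A] and [sqr A] centralize each other, and
    their intersection centralizes both. *)

Local Open Scope classical_set_scope.

Lemma sbIadd (A : skewBraceType) (a x y : A) :
  (x + a = y + a)%brace -> x = y.
Proof.
by move=> e; rewrite -(sbaddr0 x) -(sbaddrN a) sbaddA e -sbaddA sbaddrN sbaddr0.
Qed.

Lemma star_opC (A : skewBraceType) (hA : two_sided A) (a b c d : A) :
  (star_op b c + star a d = star a d + star_op b c)%brace.
Proof.
have e : ((a + b) ∘ c - (a + b) + (a + b) ∘ d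
          = a ∘ (c + d) - (c + d) + b ∘ (c + d))%brace by rewrite -sbcircD hA.
rewrite !hA !sbcircD !sboppD -!sbaddA in e.
(* Both expansions start with [a ∘ c] and end with [b ∘ d]; cancelling these leaves the two products
   in opposite orders. *)
move/(@sbaddI A): e => e; apply: (@sbIadd A (b ∘ d)%brace).
by rewrite /star /star_op -!sbaddA.
Qed.

Lemma add_subgroup_centralizer (A : skewBraceType) (S : set A) :
  add_subgroup [set x | forall y, S y -> (x + y = y + x)%brace].
Proof.
split=> [y _|x x' Cx Cx' y Sy|x Cx y Sy].
- by rewrite sbadd0 sbaddr0.
- by rewrite -sbaddA Cx' // sbaddA Cx // sbaddA.
- by apply: (@sbaddI A x); rewrite sbaddNK !sbaddA Cx // -sbaddA sbaddrN sbaddr0.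
Qed.

(** Centralizers are additive subgroups, so commutation passes from generators to the generated
    subgroup, one side at a time. *)
Lemma add_gen_centralize (A : skewBraceType) (S T : set A) :
  (forall x y, S x -> T y -> x + y = y + x)%brace ->
  forall x y, add_gen S x -> add_gen T y -> (x + y = y + x)%brace.
Proof.
move=> ST x y Sx Ty.
have Cgen (U V : set A) : (forall u v, U u -> V v -> (u + v = v + u)%brace) ->
    forall u, add_gen U u -> forall v, V v -> (u + v = v + u)%brace.
  move=> UV; apply: (smallest_sub (@add_subgroup_centralizer A V)) => u Uu v Vv.
  exact: UV.
apply: (Cgen S (add_gen T) _ x Sx y Ty) => u v Su Tv; apply: esym.
by apply: (Cgen T S _ v Tv u Su) => v' u' Tv' Su'; rewrite (ST u').
Qed.

Lemma sqr_op_sqrC (A : skewBraceType) (hA : two_sided A) (x y : A) :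
  sqr_op_set A x -> sqr_set A y -> (x + y = y + x)%brace.
Proof.
by apply: add_gen_centralize => _ _ [b [c ->]] [a [d ->]]; exact: star_opC.
Qed.

Theorem theorem4p3 (A : skewBraceType) (hA : two_sided A) :
  sqr A `&` sqr_op A `<=` add_center (add_set (sqr A) (sqr_op A))
  /\ is_two_sided_brace (ideal_type (idealI (sqr A) (sqr_op A))).
Proof.
split=> [z [z1 z2]|].
  split=> [|_ [x [y [x1 y2 ->]]]].
    exists z, (@sbzero A); split=> //; last by rewrite sbaddr0.
    exact: izero_subproof.
  have C := sqr_op_sqrC A hA.
  (* Moving [z] past [x] uses [z] in [sqr_op A]; moving it past [y] uses [z] in [sqr A]. *)
  by rewrite sbaddA (C z x) // -!sbaddA (C y z).
(* Two-sidedness restricts from [A]; for commutativity, view [u] in [sqr_op A] and [v] in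
   [sqr A]. *)
split=> [u v|u v w]; apply: val_inj; last exact: hA.
have [_ u2] := ideal_typeP u; have [v1 _] := ideal_typeP v.
exact: sqr_op_sqrC.
Qed.
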